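(* Let $\mathbb{F}$ be a field of characteristic $p>0$ and let $\mathfrak{g}$ be a finite-dimensional restricted simple Lie algebra over $\mathbb{F}$. Then, as vector spaces over $\mathbb{F}$, $$H^2_*(\mathfrak{g})\;\cong\; H^2(\mathfrak{g})\oplus \mathrm{Hom}_{\mathrm{fr}}(\mathfrak{g},\mathbb{F}),$$ so that $$\dim H^2_*(\mathfrak{g})=\dim H^2(\mathfrak{g})+\dim\mathfrak{g}.$$
   Context: A restricted simple Lie algebra over $\mathbb{F}$ is a restricted Lie algebra $(\mathfrak{g},[\cdot,\cdot],(\cdot)^{[p]})$ over $\mathbb{F}$ whose underlying Lie algebra is simple (in particular non-abelian). $H^2(\mathfrak{g})=H^2(\mathfrak{g},\mathbb{F})$ is the ordinary (Chevalley–Eilenberg) Lie algebra cohomology with coefficients in the trivial module $\mathbb{F}$. Write $C^k(\mathfrak{g})$ for the space of alternating $k$-linear maps $\mathfrak{g}^k\to\mathbb{F}$ and $\delta^k:C^k(\mathfrak{g})\to C^{k+1}(\mathfrak{g})$ for the coboundary maps, with the sign convention $\delta^1\varphi(g,h)=\varphi([g,h])$. $\mathrm{Hom}_{\mathrm{fr}}(V,W)$, for $\mathbb{F}$-vector spaces $V,W$, is the set of Frobenius homomorphisms (also called $p$-semilinear maps): $$\mathrm{Hom}_{\mathrm{fr}}(V,W)=\{f:V\to W \mid f(\alpha x+\beta y)=\alpha^pf(x)+\beta^pf(y)\ \text{for all } \alpha,\beta\in\mathbb{F},\ x,y\in V\},$$ an $\mathbb{F}$-vector space under pointwise operations. $H^2_*(\mathfrak{g})=H^2_*(\mathfrak{g},\mathbb{F})$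 is the second restricted Lie algebra cohomology group with trivial coefficients (Hochschild's restricted cohomology $\mathrm{Ext}^2_{u(\mathfrak{g})}(\mathbb{F},\mathbb{F})$, with $u(\mathfrak{g})$ the restricted universal enveloping algebra). It is computed by restricted cochains as follows. Multiple brackets are left-normed: $[g_1,g_2,\dots,g_k]=[[\dots[[g_1,g_2],g_3],\dots],g_k]$ (with $[g_1]=g_1$). For $\varphi\in C^2(\mathfrak{g})$, a map $\omega:\mathfrak{g}\to\mathbb{F}$ has the $*$-property with respect to $\varphi$ if for all $\alpha\in\mathbb{F}$, $g,h\in\mathfrak{g}$: $\omega(\alpha g)=\alpha^p\omega(g)$ and $$\omega(g+h)=\omega(g)+\omega(h)+\sum_{\substack{g_i\in\{g,h\}\\ g_1=g,\ g_2=h}}\frac{1}{\#(g)}\,\varphi([g_1,\dots,g_{p-1}],g_p),$$ where the sum is over formal sequences $(g_1,\dots,g_p)$ of symbols $g,h$ with $g_1=g$, $g_2=h$, and $\#(g)$ is the number of indices $i$ with $g_i=g$. Restricted $1$-cochains are $C^1_*(\mathfrak{g})=C^1(\mathfrak{g})$; restricted $2$-cochains are pairs $(\varphi,\omega)$ with $\varphi\in C^2(\mathfrak{g})$ and $\omega$ having the $*$-property with respect to $\varphi$. The coboundary of $\psi\in C^1_*(\mathfrak{g})$ is $(\delta^1\psi,\ g\mapsto\psi(g^{[p]}))$. A pair $(\varphi,\omega)$ is a restricted cocycle if $\delta^2\varphi=0$ and $\varphi(g,h^{[p]})-\varphi([g,\underbrace{h,\dots,h}_{p-1}],h)=0$ for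 all $g,h\in\mathfrak{g}$. $H^2_*(\mathfrak{g})$ is restricted $2$-cocycles modulo coboundaries of restricted $1$-cochains. *)

(* Defs.v *)
From HB Require Import structures.
From mathcomp Require Import all_boot all_order all_algebra.
From mathcomp Require Import generic_quotient ring_quotient.
From mathcomp Require Import boolp classical_sets functions.

Set Implicit Arguments.
Unset Strict Implicit.
Unset Printing Implicit Defensive.

Import GRing.Theory.
Local Open Scope ring_scope.
Local Open Scope quotient_scope.

(* The zmodule quotient of ring_quotient.v, with its scalar multiplication.
   submodClosed also covers semimodules, so it does not provide the zmodClosed
   structure that Quotient.quot needs; lmod_zmodClosed derives it. *)
Section LmodQuotient.
Variables (R : nzRingType) (V : lmodType R) (I : submodClosed V).

Fact lmod_zmod_closed : zmod_closed I.
Proof.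
by split=> [|x y Ix Iy]; rewrite ?rpred0 // -scaleN1r rpredD // rpredZ.
Qed.

Definition lmod_zmodClosed : zmodClosed V :=
  HB.pack (I : {pred V})
    (GRing.isZmodClosed.Build V (I : {pred V}) lmod_zmod_closed).

Definition lmod_quot : Type := Quotient.quot lmod_zmodClosed.
HB.instance Definition _ := GRing.Zmodule.on lmod_quot.

Definition lmod_proj (x : V) : lmod_quot := \pi_(Quotient.quot lmod_zmodClosed) x.
Definition lmod_repr (u : lmod_quot) : V :=
  repr (u : Quotient.quot lmod_zmodClosed).

Lemma lmod_proj_eq x y : (lmod_proj x == lmod_proj y) = (x - y \in I).
Proof. exact: (esym (Quotient.idealrBE lmod_zmodClosed x y)). Qed.

Lemma lmod_projK (u : lmod_quot) : lmod_proj (lmod_repr u) = u.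
Proof. exact: reprK. Qed.

Lemma lmod_projD : {morph lmod_proj : x y / x + y}.
Proof. by move=> x y; rewrite /lmod_proj raddfD. Qed.

Definition lmod_quot_scale (a : R) (u : lmod_quot) : lmod_quot :=
  lmod_proj (a *: lmod_repr u).

Lemma lmod_quot_scaleE a x : lmod_quot_scale a (lmod_proj x) = lmod_proj (a *: x).
Proof.
apply/eqP; rewrite lmod_proj_eq -scalerBr rpredZ // -lmod_proj_eq.
by rewrite lmod_projK.
Qed.

Fact lmod_quot_scaleA a b u :
  lmod_quot_scale a (lmod_quot_scale b u) = lmod_quot_scale (a * b) u.
Proof. by rewrite -(lmod_projK u) !lmod_quot_scaleE scalerA. Qed.

Fact lmod_quot_scale1 : left_id 1 lmod_quot_scale.
Proof. by move=> u; rewrite -(lmod_projK u) lmod_quot_scaleE scale1r. Qed.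

Fact lmod_quot_scaleDr : right_distributive lmod_quot_scale +%R.
Proof.
move=> a u v; rewrite -(lmod_projK u) -(lmod_projK v) -lmod_projD.
by rewrite !lmod_quot_scaleE scalerDr lmod_projD.
Qed.

Fact lmod_quot_scaleDl u : {morph lmod_quot_scale^~ u : a b / a + b}.
Proof.
by move=> a b; rewrite -(lmod_projK u) !lmod_quot_scaleE scalerDl lmod_projD.
Qed.

HB.instance Definition _ := GRing.Zmodule_isLmodule.Build R lmod_quot
  lmod_quot_scaleA lmod_quot_scale1 lmod_quot_scaleDr lmod_quot_scaleDl.

Fact lmod_proj_is_linear : linear lmod_proj.
Proof. by move=> a x y; rewrite lmod_projD -lmod_quot_scaleE. Qed.

HB.instance Definition _ :=
  GRing.isLinear.Build R V lmod_quot *:%R lmod_proj lmod_proj_is_linear.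
End LmodQuotient.

(* Vector.axiom n V : V is linearly isomorphic to 'rV_n *)
Definition has_dim (R : nzRingType) (V : lmodType R) (n : nat) : Prop :=
  inhabited (Vector.axiom n V).

HB.mixin Record Vector_isLie (F : fieldType) V of Vector F V := {
  lie : V -> V -> V;
  lie_linearl : forall y, linear (lie^~ y);
  lie_linearr : forall x, linear (lie x);
  liexx : forall x, lie x x = 0;
  lie_jacobi : forall x y z,
    lie (lie x y) z + lie (lie y z) x + lie (lie z x) y = 0
}.

#[short(type="lieAlgType")]
HB.structure Definition LieAlgebra (F : fieldType) :=
  {V of Vector_isLie F V & Vector F V}.

Section LieTheory.
Variables (F : fieldType) (g : lieAlgType F).

Lemma lieC (x y : g) : lie x y = - lie y x.
Proof.
have lieDl (a : g) : lie (x + y) a = lie x a + lie y a.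
  by have := lie_linearl a 1 x y; rewrite !scale1r.
have lieDr (a : g) : lie a (x + y) = lie a x + lie a y.
  by have := lie_linearr a 1 x y; rewrite !scale1r.
have := liexx (x + y).
by rewrite lieDl !lieDr !liexx add0r addr0 => /eqP; rewrite addr_eq0 => /eqP.
Qed.

Lemma lie0l (y : g) : lie 0 y = 0.
Proof. by have := lie_linearl y (-1) y y; rewrite !scaleN1r !addNr. Qed.

Lemma lieNl (x y : g) : lie (- x) y = - lie x y.
Proof.
by have := lie_linearl y (-1) x 0; rewrite !addr0 !scaleN1r lie0l addr0.
Qed.

Definition lie_ideal (U : {vspace g}) : Prop :=
  forall x y : g, x \in U -> lie x y \in U.

Definition lie_simple : Prop :=
  (exists x y : g, lie x y != 0) /\
  (forall U : {vspace g}, lie_ideal U -> U = 0%VS \/ U = fullv).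

(* [w_1, w_2, ..., w_k], left-normed *)
Definition lie_word (w : seq g) : g :=
  if w is x :: w' then foldl lie x w' else 0.

(* The sum of B [w_1, ..., w_(p-1)] w_p / #(x) over the words w of length p in
   the symbols x, y that start with x, y. A word is encoded by s : p.-tuple bool,
   where true stands for x and false for y. *)
Definition star_sum (p : nat) (W : lmodType F) (B : g -> g -> W) (x y : g) : W :=
  \sum_(s : p.-tuple bool | take 2 s == [:: true; false])
    let w := [seq if b then x else y | b <- s] in
    (count_mem true s)%:R^-1 *: B (lie_word (take p.-1 w)) (last 0 w).
End LieTheory.

(* ppowD is Jacobson's formula: collecting the words with i occurrences of x,
   star_sum p lie x y is the sum over 0 < i < p of the s_i(x, y) for which
   i s_i(x, y) is the coefficient of t^(i-1) in (ad (t x + y))^(p-1) x. *)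
HB.mixin Record LieAlgebra_isRestricted (F : fieldType) (p : nat) V
    of LieAlgebra F V := {
  ppow : V -> V;
  ppowZ : forall (a : F) (x : V), ppow (a *: x) = a ^+ p *: ppow x;
  ppowD : forall x y : V,
    ppow (x + y) = ppow x + ppow y + star_sum p (@lie F V) x y;
  lie_ppow : forall x y : V, lie (ppow x) y = iter p (lie x) y
}.

#[short(type="restrictedLieAlgType")]
HB.structure Definition RestrictedLieAlgebra (F : fieldType) (p : nat) :=
  {V of LieAlgebra_isRestricted F p V & LieAlgebra F V}.

Section HomFr.
Variables (F : fieldType) (p : nat) (V W : lmodType F).

Definition frobenius_hom : {pred V -> W} := fun f =>
  `[< forall (a b : F) (x y : V),
        f (a *: x + b *: y) = a ^+ p *: f x + b ^+ p *: f y >].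

Fact frobenius_hom_submod : submod_closed frobenius_hom.
Proof.
split=> [|c f h /asboolP Hf /asboolP Hh]; apply/asboolP => a b x y.
  by rewrite !scaler0 addr0.
rewrite !fctE Hf Hh !scalerDr !scalerA ![_ * c]mulrC.
by rewrite -!addrA; congr (_ + _); rewrite addrCA.
Qed.

HB.instance Definition _ :=
  GRing.isSubmodClosed.Build F (V -> W) frobenius_hom frobenius_hom_submod.

Definition homFr : Type := {f : V -> W | f \in frobenius_hom}.
HB.instance Definition _ := SubChoice.on homFr.
HB.instance Definition _ := [SubChoice_isSubLmodule of homFr by <:].
End HomFr.

Section Cohomology.
Variables (F : fieldType) (g : lieAlgType F).
Implicit Types (psi : g -> F^o) (phi : g -> g -> F^o).

Definition cochain2 phi : Prop :=
  [/\ forall y, linear (phi^~ y), forall x, linear (phi x)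
    & forall x, phi x x = 0].

(* Signs of the Chevalley-Eilenberg complex: [g_s, g_t], s < t, is contracted
   with sign (-1)^(s+t-1), indices starting at 1. *)
Definition delta1 psi : g -> g -> F^o := fun x y => psi (lie x y).

Definition delta2 phi : g -> g -> g -> F^o := fun x y z =>
  phi (lie x y) z - phi (lie x z) y + phi (lie y z) x.

Definition cocycle2 : {pred g -> g -> F^o} := fun phi =>
  `[< cochain2 phi /\ forall x y z, delta2 phi x y z = 0 >].

Lemma cochain2_0 : cochain2 0.
Proof. by split=> [y a u v|x a u v|//]; rewrite scaler0 addr0. Qed.

Lemma cochain2_P c phi phi' :
  cochain2 phi -> cochain2 phi' -> cochain2 (c *: phi + phi').
Proof.
have E x y : (c *: phi + phi') x y = c *: phi x y + phi' x y by [].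
case=> Hl Hr H0 [Hl' Hr' H0']; split=> [y a u v|x a u v|x]; rewrite !E.
- rewrite Hl Hl' !scalerDr !scalerA mulrC -!addrA.
  by congr (_ + _); rewrite addrCA.
- rewrite Hr Hr' !scalerDr !scalerA mulrC -!addrA.
  by congr (_ + _); rewrite addrCA.
- by rewrite H0 H0' scaler0 addr0.
Qed.

Lemma delta2_P c phi phi' x y z :
  delta2 (c *: phi + phi') x y z = c *: delta2 phi x y z + delta2 phi' x y z.
Proof.
have E u v : (c *: phi + phi') u v = c *: phi u v + phi' u v by [].
rewrite /delta2 !E scalerDr scalerBr opprD.
by rewrite [X in X + _ = _]addrACA [LHS]addrACA.
Qed.

Fact cocycle2_submod : submod_closed cocycle2.
Proof.
split=> [|c f h /asboolP[Hf Df] /asboolP[Hh Dh]]; apply/asboolP; split.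
- exact: cochain2_0.
- by move=> x y z; rewrite /delta2 subrr addr0.
- exact: cochain2_P.
- by move=> x y z; rewrite delta2_P Df Dh scaler0 addr0.
Qed.

HB.instance Definition _ :=
  GRing.isSubmodClosed.Build F (g -> g -> F^o) cocycle2 cocycle2_submod.

Definition Z2 : Type := {phi : g -> g -> F^o | phi \in cocycle2}.
HB.instance Definition _ := SubChoice.on Z2.
HB.instance Definition _ := [SubChoice_isSubLmodule of Z2 by <:].

Definition coboundary2 : {pred Z2} := fun z =>
  `[< exists psi : {linear g -> F^o}, val z = delta1 psi >].

Fact coboundary2_submod : submod_closed coboundary2.
Proof.
split=> [|c z z' /asboolP[f Hf] /asboolP[h Hh]]; apply/asboolP.
  by exists \0.
by exists (c \*: f \+ h); rewrite linearP /= Hf Hh.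
Qed.

HB.instance Definition _ :=
  GRing.isSubmodClosed.Build F Z2 coboundary2 coboundary2_submod.

Definition H2 : lmodType F := lmod_quot coboundary2.

Lemma delta1_cocycle2 (psi : {linear g -> F^o}) : delta1 psi \in cocycle2.
Proof.
apply/asboolP; split; first split.
- by move=> y a u v; rewrite /delta1 lie_linearl linearP.
- by move=> x a u v; rewrite /delta1 lie_linearr linearP.
- by move=> x; rewrite /delta1 liexx linear0.
move=> x y z; rewrite /delta2 /delta1 -linearB -linearD /=.
rewrite -[RHS](linear0 psi) -(lie_jacobi x y z); congr (psi _).
by rewrite (lieC z x) lieNl addrAC.
Qed.
End Cohomology.

Section RestrictedCohomology.
Variables (F : fieldType) (p : nat) (g : restrictedLieAlgType F p).
Implicit Types (psi : g -> F^o) (phi : g -> g -> F^o) (omega : g -> F^o).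

Definition star_property phi omega : Prop :=
  (forall (a : F) (x : g), omega (a *: x) = a ^+ p *: omega x) /\
  (forall x y : g, omega (x + y) = omega x + omega y + star_sum p phi x y).

Definition res_cocycle2 : {pred (g -> g -> F^o) * (g -> F^o)} := fun c =>
  `[< [/\ cochain2 c.1, star_property c.1 c.2,
          forall x y z, delta2 c.1 x y z = 0
        & forall x y : g,
            c.1 x (ppow y) - c.1 (lie_word (x :: nseq p.-1 y)) y = 0] >].

Definition res_delta1 psi : (g -> g -> F^o) * (g -> F^o) :=
  (delta1 psi, fun x => psi (ppow x)).

Lemma star_sum_P c phi phi' x y :
  star_sum p (c *: phi + phi') x y =
    c *: star_sum p phi x y + star_sum p phi' x y.
Proof.
rewrite /star_sum scaler_sumr -big_split; apply: eq_bigr => s _ /=.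
by rewrite -[RHS]/(_ *: _ + _ *: _) /= scalerDr !scalerA mulrC.
Qed.

Fact res_cocycle2_submod : submod_closed res_cocycle2.
Proof.
split=> [|c [f u] [h v]].
  apply/asboolP; split=> //=.
  - exact: cochain2_0.
  - split=> [a x|x y]; first by rewrite scaler0.
    by rewrite /star_sum big1 ?addr0 // => s _; rewrite scaler0.
  - by move=> x y z; rewrite /delta2 subrr addr0.
  - by move=> x y; rewrite subrr.
move=> /asboolP[/= Hf [Zu Du] Df Pf] /asboolP[/= Hh [Zv Dv] Dh Ph].
have E x y : (c *: f + h) x y = c *: f x y + h x y by [].
have E1 x : (c *: u + v) x = c *: u x + v x by [].
apply/asboolP; split=> /=.
- exact: cochain2_P.
- split=> [a x|x y]; rewrite !E1.
    by rewrite Zu Zv scalerDr !scalerA mulrC.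
  rewrite Du Dv star_sum_P !scalerDr.
  by rewrite [X in _ = X + _]addrACA [RHS]addrACA.
- by move=> x y z; rewrite delta2_P Df Dh scaler0 addr0.
- move=> x y; rewrite !E opprD addrACA -scalerBr.
  by rewrite Pf Ph scaler0 addr0.
Qed.

HB.instance Definition _ := GRing.isSubmodClosed.Build F
  ((g -> g -> F^o) * (g -> F^o))%type res_cocycle2 res_cocycle2_submod.

Lemma res_delta1_cocycle2 (psi : {linear g -> F^o}) :
  p \in [pchar F] -> res_delta1 psi \in res_cocycle2.
Proof.
move=> charFp; have p_gt0 := prime_gt0 (pcharf_prime charFp).
have /asboolP[C2 D2] := delta1_cocycle2 psi.
apply/asboolP; split=> //=.
  split=> [a x|x y]; first by rewrite ppowZ linearZ.
  rewrite ppowD !linearD; congr (_ + _); rewrite /star_sum linear_sum.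
  by apply: eq_bigr => s _ /=; rewrite linearZ.
have foldlE n (x y : g) :
    foldl lie x (nseq n y) = (-1) ^+ n *: iter n (lie y) x.
  elim: n x => [|n IHn] x; first by rewrite scale1r.
  rewrite /= IHn (lieC x y).
  have -> : iter n (lie y) (- lie y x) = - iter n (lie y) (lie y x).
    by elim: n {IHn} => //= n ->; rewrite lieC lieNl -lieC.
  by rewrite -iterSr exprS mulN1r scaleNr scalerN.
move=> x y; rewrite /delta1 /lie_word foldlE.
rewrite lieC lie_ppow -linearB.
have lieSl n : lie ((-1) ^+ n *: iter n (lie y) x) y =
    (-1) ^+ n.+1 *: iter n.+1 (lie y) x.
  have := lie_linearl y ((-1) ^+ n) (iter n (lie y) x) 0.
  by rewrite lie0l !addr0 => ->; rewrite lieC exprS mulN1r scaleNr scalerN.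
rewrite lieSl prednK //.
have -> : (-1 : F) ^+ p = -1.
  by rewrite -(pFrobenius_autE charFp) pFrobenius_autN pFrobenius_aut1.
by rewrite scaleN1r opprK addNr linear0.
Qed.

Definition res_Z2 : Type :=
  {c : (g -> g -> F^o) * (g -> F^o) | c \in res_cocycle2}.
HB.instance Definition _ := SubChoice.on res_Z2.
HB.instance Definition _ := [SubChoice_isSubLmodule of res_Z2 by <:].

Definition res_coboundary2 : {pred res_Z2} := fun z =>
  `[< exists psi : {linear g -> F^o}, val z = res_delta1 psi >].

Fact res_coboundary2_submod : submod_closed res_coboundary2.
Proof.
split=> [|c z z' /asboolP[f Hf] /asboolP[h Hh]]; apply/asboolP.
  by exists \0.
by exists (c \*: f \+ h); rewrite linearP /= Hf Hh.
Qed.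

HB.instance Definition _ :=
  GRing.isSubmodClosed.Build F res_Z2 res_coboundary2 res_coboundary2_submod.

Definition res_H2 : lmodType F := lmod_quot res_coboundary2.
End RestrictedCohomology.

(* Main.v *)
Require Import Defs.
From HB Require Import structures.
From mathcomp Require Import all_boot all_order all_algebra.
From mathcomp Require Import zify.
From mathcomp.multinomials Require Import mpoly.
Set Implicit Arguments.
Unset Strict Implicit.
Unset Printing Implicit Defensive.
Import GRing.Theory.
Local Open Scope ring_scope.

(* The projection (phi, omega) |-> phi has kernel Hom_fr(g, F), since the
   *-property with respect to 0 is p-semilinearity, and both sides are cut down
   by the same coboundaries because delta^1 is injective when [g, g] = g. The
   point is that every 2-cocycle phi is hit. The central extension E of g by phi
   gives two facts. First, (ad y)^p - ad y^[p] is a derivation of E with central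
   values, so it kills commutators; this is the second cocycle condition. Second,
   omega is the central component of a p-semilinear-up-to-Jacobson map
   P : E -> E. Such a P exists on any Lie algebra of characteristic p: for the
   generic vector u = sum_i t_i e_i the form sum_i (ad u)^(p-1) e_i dt_i is closed
   and has no term t_i^(p-1) dt_i, hence has a homogeneous primitive f, and P is
   evaluation of f. The derivative of s |-> f(s x + y) is (ad (s x + y))^(p-1) x,
   whose coefficients are the sums over words in Jacobson's formula. *)

Definition linear_pack (F : fieldType) (V W : lmodType F) (f : V -> W)
    (f_lin : linear f) :
  {linear V -> W} := HB.pack f (GRing.isLinear.Build F V W *:%R f f_lin).

(** * Closed forms *)

Lemma sum_bin_col n k : (\sum_(i < n) 'C(i, k) = 'C(n, k.+1))%N.
Proof. by elim: n => [|n IHn]; rewrite ?big_ord0 // big_ord_recr /= IHn binS. Qed.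

Section ClosedForm.
Variables (L : zmodType) (br : L -> L -> L) (D : L -> L).
Hypothesis brC : forall v w, br v w = - br w v.
Hypothesis D_add : {morph D : x y / x + y}.
Hypothesis D_br : forall v w, D (br v w) = br (D v) w + br v (D w).

Lemma iter_derivation N v w :
  iter N D (br v w) =
    \sum_(k < N.+1) br (iter k D v) (iter (N - k) D w) *+ 'C(N, k).
Proof.
have D0 : D 0 = 0 by apply: (addrI (D 0)); rewrite -D_add !addr0.
have DMn n x : D (x *+ n) = D x *+ n.
  by elim: n => [|n IHn]; rewrite ?mulr0n // !mulrS D_add IHn.
elim: N => [|N IHN]; first by rewrite big_ord1.
rewrite iterS IHN (big_morph D D_add D0).
under eq_bigr => k _ do rewrite DMn D_br mulrnDl.
rewrite big_split [RHS]big_ord_recl /= bin0 mulr1n.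
under [in RHS]eq_bigr => k _ do rewrite /bump /= add1n binS mulrnDr subSS.
rewrite [in RHS]big_split /= addrC [RHS]addrA; congr (_ + _).
rewrite big_ord_recl [in RHS]big_ord_recr /= (bin_small (ltnSn N)) mulr0n addr0.
rewrite bin0 mulr1n subn0; congr (_ + _); apply: eq_bigr => k _.
by rewrite /bump add1n -[D (iter (N - _) _ _)]iterS subnSK.
Qed.

(* Expanding by the Leibniz rule, the left-hand side is the sum of the
   'C(p - 1, k + 1) * br (D^k w) (D^(p-2-k) v), and 'C(p - 1, k + 1) is congruent
   to - 'C(p - 1, k) mod p. *)
Lemma closed_form_sym q v w :
  prime q.+2 -> (forall x : L, x *+ q.+2 = 0) ->
  \sum_(i < q.+1) iter i D (br w (iter (q - i) D v)) =
  \sum_(i < q.+1) iter i D (br v (iter (q - i) D w)).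
Proof.
move=> pr_p charL.
have expand x y : \sum_(i < q.+1) iter i D (br x (iter (q - i) D y)) =
    \sum_(k < q.+1) br (iter k D x) (iter (q - k) D y) *+ 'C(q.+1, k.+1).
  (* Since ['C(i, k) = 0] for [k > i], all Leibniz sums may run up to [q]; summing over [i] then
     runs down a column of Pascal's triangle. *)
  transitivity (\sum_(i < q.+1) \sum_(k < q.+1)
      br (iter k D x) (iter (q - k) D y) *+ 'C(i, k)).
    apply: eq_bigr => i _; rewrite iter_derivation.
    rewrite (big_ord_widen q.+1 (fun k => br (iter k D x)
      (iter (i - k) D (iter (q - i) D y)) *+ 'C(i, k))) // big_mkcond /=.
    apply: eq_bigr => k _; case: ifP => [lek|/negbT]; last first.
      by rewrite -leqNgt => ?; rewrite bin_small ?mulr0n.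
    rewrite -iterD addnC addnBA; first by rewrite subnK // -ltnS.
    by rewrite -ltnS.
  rewrite exchange_big; apply: eq_bigr => k _.
  by rewrite sumrMnr sum_bin_col.
(* Reversing [k] on the right and using antisymmetry makes the brackets agree; the coefficients add
   up to ['C(q.+2, k.+1)], a multiple of the prime [q.+2]. *)
rewrite !expand [RHS](reindex_inj rev_ord_inj) /=; apply/eqP.
rewrite -subr_eq0 -sumrB big1 // => k _.
have lek : (k <= q)%N by rewrite -ltnS.
rewrite subSS subKn // [br (iter _ D v) _]brC mulNrn opprK -mulrnDr.
rewrite -subSn // (bin_sub (leqW lek)) -binS.
have /dvdnP[m Em] : (q.+2 %| 'C(q.+2, k.+1))%N by exact: prime_dvd_bin.
by rewrite Em mulnC mulrnA charL mul0rn.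
Qed.
End ClosedForm.

(** * Evaluation of polynomials and restriction to lines *)

Section MpolyEval.
Variables (F : fieldType) (n : nat).

(** Values in a general algebra serve both for points ([S = F^o]) and for lines ([S = {poly F}]). *)
Definition mpoly_at (S : comAlgType F) (v : 'I_n -> S) : {mpoly F[n]} -> S :=
  mmap (in_alg S) v.

HB.instance Definition _ (S : comAlgType F) (v : 'I_n -> S) :=
  GRing.RMorphism.copy (@mpoly_at S v) (mmap (in_alg S) v).

Fact mpoly_at_scalable (S : comAlgType F) (v : 'I_n -> S) : scalable (@mpoly_at S v).
Proof. by move=> c f; rewrite /mpoly_at mmapZ mulr_algl. Qed.

HB.instance Definition _ (S : comAlgType F) (v : 'I_n -> S) :=
  GRing.isScalable.Build F {mpoly F[n]} S *:%R (@mpoly_at S v)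
    (@mpoly_at_scalable S v).

Lemma mpoly_atE (S : comAlgType F) (v : 'I_n -> S) f :
  mpoly_at v f = \sum_(m <- msupp f) f@_m *: \prod_i v i ^+ m i.
Proof. by apply: eq_bigr => m _; rewrite mulr_algl. Qed.

Lemma eq_mpoly_at (S : comAlgType F) (v w : 'I_n -> S) f :
  v =1 w -> mpoly_at v f = mpoly_at w f.
Proof.
move=> vw; rewrite !mpoly_atE; apply: eq_bigr => m _; congr (_ *: _).
by apply: eq_bigr => i _; rewrite vw.
Qed.

Lemma mpoly_atX (S : comAlgType F) (v : 'I_n -> S) i : mpoly_at v 'X_i = v i.
Proof. by rewrite /mpoly_at mmapX mmap1U. Qed.

Lemma mpoly_atZ (S : comAlgType F) (v : 'I_n -> S) a d f : f \is d.-homog ->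
  mpoly_at (fun i => a * v i) f = a ^+ d * mpoly_at v f.
Proof.
move=> /dhomogP hf; rewrite !mpoly_atE mulr_sumr !big_seq.
apply: eq_bigr => m /hf; rewrite /= mdegE => <-; rewrite -scalerAr.
congr (_ *: _); rewrite -prodrXr -big_split /=.
by apply: eq_bigr => i _; rewrite exprMn.
Qed.

(** At a coordinate vector every other monomial of degree [d] vanishes, so the coefficient of a pure
    power can be read off as a value. *)
Lemma mpoly_at_delta i d f : f \is d.-homog ->
  mpoly_at (fun j => (j == i)%:R : F^o) f = f@_(U_(i) *+ d).
Proof.
move=> /dhomogP hf; rewrite mpoly_atE.
have vanish m : m \in msupp f -> m != (U_(i) *+ d)%MM ->
    \prod_j ((j == i)%:R : F^o) ^+ m j = 0.
  move=> /hf; rewrite /= mdegE => dm nm; apply/eqP; rewrite prodf_seq_eq0.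
  apply/hasP; suff /existsP[j /andP[nj mj]] : [exists j, (j != i) && (m j != 0%N)].
    by exists j; rewrite ?mem_index_enum // (negPf nj) expr0n (negPf mj) eqxx.
  apply: contraNT nm; rewrite negb_exists => /forallP m0.
  have mj j : j != i -> m j = 0%N.
    by move=> nj; apply/eqP; have := m0 j; rewrite nj negbK.
  apply/eqP/mnmP => j; rewrite mulmnE mnm1E -dm (bigD1 i) //= big1 ?addn0 //.
  by rewrite eq_sym; have [->|/mj ->] := eqVneq j i; rewrite ?mul1n.
have [inf|ninf] := boolP ((U_(i) *+ d)%MM \in msupp f); last first.
  rewrite (memN_msupp_eq0 ninf) big_seq big1 // => m mf.
  by rewrite vanish ?scaler0 //; apply: contraNneq ninf => <-.
rewrite (bigD1_seq _ inf) ?msupp_uniq //= [X in _ + X]big_seq_cond.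
rewrite [X in _ + X]big1 ?addr0 => [|m /andP[mf nm]]; last first.
  by rewrite vanish ?scaler0.
rewrite big1 ?[LHS]mulr1 // => j _; rewrite mulmnE mnm1E eq_sym.
by case: eqVneq => _; rewrite ?expr1n ?mul0n ?expr0.
Qed.

Variables a b : 'I_n -> F.

(** The restriction to the line [t a + b], with values at [b] and [a + b] for [t = 0] and
    [t = 1]. *)
Definition mpoly_line : {mpoly F[n]} -> {poly F} :=
  mpoly_at (fun k => a k *: 'X + (b k)%:P).

Lemma horner_mpoly_line c (v : 'I_n -> F^o) f :
  (forall k, a k * c + b k = v k) -> (mpoly_line f).[c] = mpoly_at v f.
Proof.
move=> Ev; rewrite /mpoly_line !mpoly_atE horner_sum; apply: eq_bigr => m _.
rewrite hornerZ horner_prod; congr (_ * _); apply: eq_bigr => k _.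
by rewrite horner_exp hornerD hornerZ hornerX hornerC Ev.
Qed.

(** The chain rule. It is stable under products and linear combinations, which reduces it to
    constants and variables. *)
Lemma deriv_mpoly_line f :
  (mpoly_line f)^`() = \sum_k a k *: mpoly_line f^`M(k).
Proof.
pose P g := (mpoly_line g)^`() = \sum_k a k *: mpoly_line g^`M(k).
have PM g h : P g -> P h -> P (g * h).
  rewrite /P => Pg Ph; rewrite /mpoly_line rmorphM derivM Pg Ph.
  rewrite mulr_suml mulr_sumr -big_split; apply: eq_bigr => k _ /=.
  by rewrite mderivM rmorphD !rmorphM scalerDr -scalerAl -scalerAr.
have P1 : P 1.
  rewrite /P /mpoly_line rmorph1 derivC big1 // => k _.
  rewrite -mpolyC1 mderivC. by rewrite rmorph0 scaler0.
rewrite -/(P f); elim/mpolyind: f => [|c m f _ _ Pf].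
  rewrite /P /mpoly_line rmorph0 deriv0 big1 // => k _.
  by rewrite mderiv0 rmorph0 scaler0.
have PX : P 'X_[m].
  rewrite mpolyXE_id; elim/big_rec: _ => // i g _. apply: (PM).
  elim: (m i) => [|d IHd]; rewrite ?expr0 // exprS; apply: (PM) => //.
  rewrite /P /mpoly_line mpoly_atX derivD derivZ derivX derivC addr0.
  rewrite (bigD1 i) //= big1 ?addr0 => [|k nk]; rewrite mderivX mnm1E.
    by rewrite eqxx scale1r -{1}[U_(i)%MM]add0m addmK mpolyX0 rmorph1 alg_polyC.
  by rewrite eq_sym (negPf nk) scale0r rmorph0 scaler0.
move: PX Pf; rewrite /P /mpoly_line linearD linearZ derivD derivZ => -> ->.
rewrite scaler_sumr -big_split; apply: eq_bigr => k _ /=.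
rewrite mderivD mderivZ [mpoly_at _ (_ + _)]linearD /= mpoly_at_scalable.
by rewrite scalerDr !scalerA [c * _]mulrC.
Qed.

Lemma mpoly_line_top f d : f \is d.-homog ->
  (size (mpoly_line f) <= d.+1)%N /\
  (mpoly_line f)`_d = mpoly_at (a : 'I_n -> F^o) f.
Proof.
move=> /dhomogP hf; rewrite /mpoly_line !mpoly_atE.
(* The formal degree [e] may exceed the true degree, as [c] may be zero; with this convention [K] is
   multiplicative. *)
pose K (g : {poly F}) e (c : F^o) := (size g <= e.+1)%N /\ g`_e = c.
have K1 : K 1 0%N 1 by rewrite /K size_poly1 coef1.
have KM g e c g' e' c' : K g e c -> K g' e' c' -> K (g * g') (e + e')%N (c * c').
  move=> [sg cg] [sg' cg']; split.
    by rewrite (leq_trans (size_polyMleq _ _)) // -ltnS; lia.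
  rewrite coefM (bigD1 (inord e)) //= inordK ?ltnS ?leq_addr // addKn cg cg'.
  rewrite big1 ?addr0 // => i; rewrite -val_eqE /= inordK ?ltnS ?leq_addr // => ni.
  have [lt_ie|le_ei] := ltnP i e.
    by rewrite [X in _ * X]nth_default ?mulr0 // (leq_trans sg') // ltn_subRL; lia.
  by rewrite [X in X * _]nth_default ?mul0r // (leq_trans sg) // ltn_neqAle eq_sym ni.
have Kmon (m : 'X_{1..n}) : K (\prod_i (a i *: 'X + (b i)%:P) ^+ m i) (mdeg m)
    (\prod_i (a i : F^o) ^+ m i).
  rewrite mdegE; elim/big_rec3: _ => // i c e g _; apply: (KM).
  elim: (m i) => [|l IHl]; rewrite ?expr0 // !exprS -add1n; apply: (KM) => //.
  split; last by rewrite coefD coefZ coefX coefC addr0 mulr1.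
  by rewrite -mul_polyC size_MXaddC; case: ifP; rewrite ?ltnS ?size_polyC_leq1.
split.
  rewrite big_seq; apply: (big_ind (fun g : {poly F} => size g <= d.+1)%N).
  - by rewrite size_poly0.
  - by move=> g g' sg sg'; rewrite (leq_trans (size_polyD _ _)) // geq_max sg.
  move=> m /hf /= dm.
  by rewrite (leq_trans (size_scale_leq _ _)) // -dm; case: (Kmon m).
rewrite coef_sum !big_seq; apply: eq_bigr => m /hf /= dm.
by rewrite coefZ; have [_] := Kmon m; rewrite dm => ->.
Qed.
End MpolyEval.

(* In characteristic p a closed homogeneous form of degree p - 1 is exact as
   soon as it has no component ['X_i ^+ (p - 1) d 'X_i], the only kind of monomial
   whose primitive would require a division by p. *)
Lemma mpoly_potential (F : fieldType) n p (th : 'I_n -> {mpoly F[n]}) :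
  p \in [pchar F] -> (forall i, th i \is (p.-1).-homog) ->
  (forall i j, (th i)^`M(j) = (th j)^`M(i)) ->
  (forall i, (th i)@_(U_(i) *+ p.-1) = 0) ->
  exists2 f : {mpoly F[n]}, f \is p.-homog & forall i, f^`M(i) = th i.
Proof.
move=> charFp th_homog th_closed th_diag.
have p_gt0 : (0 < p)%N by rewrite prime_gt0 // (pcharf_prime charFp).
(* A primitive must have [c m *+ m i = (th i)@_(m - U_(i))] for all [i]; any one index with
   [m i != 0] serves to define [c m]. *)
pose c (m : 'X_{1..n}) : F := if [pick i | m i != 0%N] is Some i
  then (th i)@_(m - U_(i)) / (m i)%:R else 0.
(* The choice of index does not matter: closedness, read at the monomial [m - U_(i) - U_(j)],
   relates the formulas for [i] and [j]. *)
have cP (m : 'X_{1..n}) i : mdeg m = p -> m i != 0%N ->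
    c m *+ m i = (th i)@_(m - U_(i)).
  move=> dm mi; rewrite /c; case: pickP => [j mj|m0]; last by rewrite m0 in mi.
  have mle k : (m k <= p)%N by rewrite -dm mdegE (bigD1 k) ?leq_addr.
  have natF_neq0 k : (0 < m k < p)%N -> (m k)%:R != 0 :> F.
    by move=> /andP[k0 kp]; rewrite -(dvdn_pcharf charFp) gtnNdvd.
  (* If [m j = p], division by [m j] is impossible in [F]; but then [m = U_(j) *+ p], and both sides
     vanish by [th_diag]. *)
  have [mjp|mjp] := eqVneq (m j) p.
    have m0 k : k != j -> m k = 0%N.
      move=> nk; apply/eqP; rewrite -leqn0 -(leq_add2l p) addn0 -{1}mjp -dm mdegE.
      by rewrite (bigD1 j) //= leq_add2l (bigD1 k) ?leq_addr.
    have Em : m = (U_(j) *+ p)%MM.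
      apply/mnmP => k; rewrite mulmnE mnm1E eq_sym.
      by have [->|/m0 ->] := eqVneq k j; rewrite ?mul1n.
    have -> : i = j by apply: contraNeq mi => /m0 ->.
    have -> : (th j)@_(m - U_(j)) = 0.
      by rewrite Em -{1}(prednK p_gt0) mulmSr addmK th_diag.
    by rewrite mul0r mul0rn.
  have mj_unit : (m j)%:R != 0 :> F.
    by rewrite natF_neq0 // lt0n mj ltn_neqAle mjp mle.
  apply: (mulIf mj_unit); rewrite mulrnAl mulfVK // mulr_natr.
  have [->//|nij] := eqVneq i j.
  have E k l : k != l -> m l != 0%N -> m k != 0%N ->
      ((th k)^`M(l))@_(m - U_(k) - U_(l)) = (th k)@_(m - U_(k)) *+ m l.
    move=> nkl ml mk; rewrite mcoeff_mderiv submK; last first.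
      by rewrite lep1mP mnmBE mnm1E (negPf nkl) subn0.
    congr (_ *+ _); rewrite !mnmBE !mnm1E eqxx (negPf nkl) subn0 subn1.
    by rewrite prednK ?lt0n.
  have nji : j != i by rewrite eq_sym.
  rewrite -(E _ _ nji mi mj) -(E _ _ nij mj mi) th_closed.
  by rewrite !submDA addmC.
pose f : {mpoly F[n]} :=
  \sum_(m : 'X_{1..n < p.+1}) (if mdeg m == p then c m else 0) *: 'X_[m].
have coef_f m : f@_m = if mdeg m == p then c m else 0.
  rewrite /f; have [lemp|ltpm] := leqP (mdeg m) p.
    by rewrite (mcoeff_mpoly (fun m => if mdeg m == p then c m else 0)).
  rewrite raddf_sum big1 ?gtn_eqF // => k _ /=.
  rewrite mcoeffZ mcoeffX; have [E|_] := eqVneq (bmnm k) m; last by rewrite mulr0.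
  by have := bmdeg k; rewrite E ltnS leqNgt ltpm.
exists f.
  apply/dhomogP => m; rewrite mcoeff_msupp coef_f /=.
  by have [->//|_] := eqVneq (mdeg m) p; rewrite eqxx.
move=> i; apply/mpolyP => m; rewrite mcoeff_mderiv coef_f mdegD mdeg1 addn1.
have [dm|dm] := eqVneq (mdeg m) p.-1; last first.
  rewrite (dhomog_nemf_coeff (th_homog i) dm) ifN ?mul0rn //.
  by apply: contraNneq dm => <-.
rewrite dm prednK // eqxx.
have := @cP (m + U_(i))%MM i; rewrite mnmDE mnm1E eqxx addn1 addmK; apply => //.
by rewrite mdegD mdeg1 dm addn1 prednK.
Qed.

(** * Jacobson's formula *)

Section LieBracket.
Variables (F : fieldType) (E : lieAlgType F).
Implicit Types (u v x y : E).

Lemma lieDl y : {morph (@lie F E)^~ y : u v / u + v}.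
Proof. by move=> u v; have := lie_linearl y 1 u v; rewrite !scale1r. Qed.

Lemma lieDr x : {morph @lie F E x : u v / u + v}.
Proof. by move=> u v; have := lie_linearr x 1 u v; rewrite !scale1r. Qed.

Lemma lie0r x : lie x 0 = 0.
Proof. by rewrite lieC lie0l oppr0. Qed.

Lemma lieZr x y a : lie x (a *: y) = a *: lie x y.
Proof. by have := lie_linearr x a y 0; rewrite lie0r !addr0. Qed.

Lemma lieZl x y a : lie (a *: x) y = a *: lie x y.
Proof. by rewrite lieC lieZr -scalerN -lieC. Qed.

Lemma lie_sumr (I : finType) x (f : I -> E) :
  lie x (\sum_i f i) = \sum_i lie x (f i).
Proof. exact: (big_morph (lie x) (lieDr x) (lie0r x)). Qed.

Lemma lie_suml (I : finType) x (f : I -> E) :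
  lie (\sum_i f i) x = \sum_i lie (f i) x.
Proof. exact: (big_morph (lie^~ x) (lieDl x) (lie0l x)). Qed.

(** The Jacobi identity for right bracketing by [y], the operation that left-normed words
    iterate. *)
Lemma lie_derivation y u v : lie (lie u v) y = lie (lie u y) v + lie u (lie v y).
Proof.
have /eqP := lie_jacobi u v y.
by rewrite (lieC y u) lieNl (lieC (lie v y) u) addrAC subr_eq0 subr_eq addrC => /eqP.
Qed.

Lemma foldl_lie_nseq n x y : foldl lie x (nseq n y) = iter n (lie^~ y) x.
Proof. by elim: n x => //= n IHn x; rewrite IHn -iterSr. Qed.

Lemma iter_lie_sign n x y : iter n (lie^~ y) x = (-1) ^+ n *: iter n (lie y) x.
Proof.
elim: n => [|n IHn]; first by rewrite scale1r.
by rewrite /= IHn lieZl lieC exprS mulN1r scaleNr scalerN.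
Qed.

(** In the Leibniz expansion of the [p]-th iterate all inner binomial coefficients are divisible by
    [p]. *)
Lemma iter_lie_pchar p y u v : p \in [pchar F] ->
  iter p (lie^~ y) (lie u v) =
    lie (iter p (lie^~ y) u) v + lie u (iter p (lie^~ y) v).
Proof.
move=> charFp; have pr_p := pcharf_prime charFp.
have kill k : (p %| k)%N -> forall w : E, w *+ k = 0.
  by move=> /dvdnP[c ->] w; rewrite -scaler_nat natrM (pcharf0 charFp) mulr0 scale0r.
rewrite (iter_derivation (lieDl y) (lie_derivation y)) big_ord_recl.
case: p charFp pr_p kill => // p charFp pr_p kill.
rewrite big_ord_recr [X in _ + (X + _)]big1 => [|k _]; last first.
  by apply: kill; rewrite prime_dvd_bin //= ltnS.
by rewrite [X in _ + X]add0r /= add0n subnn bin0 binn !mulr1n addrC.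
Qed.

(** The kernel contains every bracket, so it is an ideal, and a nonzero one because some bracket is
    nonzero; by simplicity it is everything. *)
Lemma lie_simple_linear_eq0 (psi : {linear E -> F^o}) : lie_simple E ->
  (forall x y, psi (lie x y) = 0) -> forall x, psi x = 0.
Proof.
move=> [[x0 [y0 nz]] simple] psi0.
have inK x : (x \in lker (linfun psi)) = (psi x == 0) by rewrite memv_ker lfunE.
have [x y _|K0|KT x] := simple (lker (linfun psi)).
- by rewrite inK psi0.
- have : lie x0 y0 \in lker (linfun psi) by rewrite inK psi0.
  by rewrite K0 memv0 (negPf nz).
by apply/eqP; rewrite -inK KT memvf.
Qed.

End LieBracket.

(** * Extension of scalars *)

Section ScalarExtension.
Variables (F : fieldType) (E : lieAlgType F).
Local Notation n := (\dim {:E}).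
Local Notation b := (vbasis {:E}).

(** Row vectors over [R] model the tensor product of [R] and [E] in the coordinates of a basis;
    [ext_lie] is the [R]-bilinear extension of the bracket, given by structure constants. *)
Definition ext_vec (R : comAlgType F) (x : E) : 'rV[R]_n :=
  \row_k (coord b k x)%:A.

Definition ext_lie (R : comAlgType F) (v w : 'rV[R]_n) : 'rV[R]_n :=
  \row_k \sum_(i < n) \sum_(j < n) coord b k (lie b`_i b`_j) *: (v 0 i * w 0 j).

Section Bracket.
Variable R : comAlgType F.
Implicit Types (u v w : 'rV[R]_n).

Lemma ext_vecP a x y : ext_vec R (a *: x + y) = a%:A *: ext_vec R x + ext_vec R y.
Proof.
by apply/rowP => k; rewrite !mxE linearP scalerDl mulr_algl scalerA.
Qed.

Lemma ext_vecD x y : ext_vec R (x + y) = ext_vec R x + ext_vec R y.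
Proof. by have := ext_vecP 1 x y; rewrite !scale1r. Qed.

Lemma ext_vec_basis (i : 'I_n) : ext_vec R b`_i = delta_mx 0 i.
Proof.
apply/rowP => k; rewrite !mxE coord_free ?(basis_free (vbasisP _)) //.
by rewrite eqxx eq_sym; case: eqP => _; rewrite ?scale1r ?scale0r.
Qed.

(** The image of [E] spans over [R], so multilinear identities such as Jacobi's need only be checked
    there. *)
Lemma ext_vec_ind (P : 'rV[R]_n -> Prop) :
  P 0 -> (forall a v w, P v -> P w -> P (a *: v + w)) ->
  (forall x, P (ext_vec R x)) -> forall v, P v.
Proof.
move=> P0 PL PE v; rewrite [v]row_sum_delta.
elim/big_rec: _ => // i w _ Pw; apply: PL => //.
by rewrite -ext_vec_basis.
Qed.

Lemma ext_lie_linearl w : linear (@ext_lie R ^~ w).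
Proof.
move=> a u v; apply/rowP => k; rewrite !mxE mulr_sumr -big_split.
apply: eq_bigr => i _; rewrite mulr_sumr -big_split; apply: eq_bigr => j _.
by rewrite !mxE mulrDl scalerDr -mulrA scalerAr.
Qed.

Lemma ext_lie_linearr v : linear (@ext_lie R v).
Proof.
move=> a u w; apply/rowP => k; rewrite !mxE mulr_sumr -big_split.
apply: eq_bigr => i _; rewrite mulr_sumr -big_split; apply: eq_bigr => j _.
by rewrite !mxE mulrDr scalerDr mulrCA scalerAr.
Qed.

Lemma ext_lieDl w : {morph @ext_lie R ^~ w : u v / u + v}.
Proof. by move=> u v; have := ext_lie_linearl w 1 u v; rewrite !scale1r. Qed.

Lemma ext_lieDr v : {morph @ext_lie R v : u w / u + w}.
Proof. by move=> u w; have := ext_lie_linearr v 1 u w; rewrite !scale1r. Qed.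

Lemma ext_lie0l w : ext_lie 0 w = 0 :> 'rV[R]_n.
Proof. by apply: (addrI (ext_lie 0 w)); rewrite -ext_lieDl !addr0. Qed.

Lemma ext_lie0r v : ext_lie v 0 = 0 :> 'rV[R]_n.
Proof. by apply: (addrI (ext_lie v 0)); rewrite -ext_lieDr !addr0. Qed.

Lemma ext_lieC v w : ext_lie v w = - ext_lie w v.
Proof.
apply/rowP => k; rewrite !mxE exchange_big -sumrN; apply: eq_bigr => i _.
rewrite -sumrN; apply: eq_bigr => j _.
by rewrite lieC linearN scaleNr mulrC.
Qed.

Lemma ext_lie_vec x y : ext_lie (ext_vec R x) (ext_vec R y) = ext_vec R (lie x y).
Proof.
apply/rowP => k; rewrite !mxE.
rewrite {2}(coord_vbasis (memvf x)) {2}(coord_vbasis (memvf y)).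
rewrite lie_suml linear_sum scaler_suml; apply: eq_bigr => i _.
rewrite lie_sumr linear_sum scaler_suml; apply: eq_bigr => j _.
rewrite !mxE lieZl lieZr !linearZ /= mulr_algl !scalerA.
by rewrite -[in LHS]mulrA [in LHS]mulrC mulrA.
Qed.

Lemma ext_lie_jacobi u v w :
  ext_lie (ext_lie v w) u = ext_lie (ext_lie v u) w + ext_lie v (ext_lie w u).
Proof.
move: v w u; elim/ext_vec_ind => [w u|a v v' IHv IHv'|x].
- by rewrite !ext_lie0l addr0.
- by move=> w u; rewrite !ext_lie_linearl IHv IHv' scalerDr addrACA.
elim/ext_vec_ind => [u|a w w' IHw IHw' u|y].
- by rewrite !ext_lie0l !ext_lie0r ext_lie0l addr0.
- by rewrite !(ext_lie_linearl, ext_lie_linearr) IHw IHw' scalerDr addrACA.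
elim/ext_vec_ind => [|a u u' IHu IHu'|z].
- by rewrite !ext_lie0r !ext_lie0l addr0.
- by rewrite !(ext_lie_linearl, ext_lie_linearr) IHu IHu' scalerDr addrACA.
rewrite !ext_lie_vec -ext_vecD; congr ext_vec; have /eqP := lie_jacobi x y z.
rewrite (lieC z x) lieNl (lieC (lie y z) x) addrAC subr_eq0 subr_eq.
by rewrite addrC => /eqP.
Qed.
End Bracket.

Lemma map_ext_vec (R S : comAlgType F) (h : {lrmorphism R -> S}) x :
  map_mx h (ext_vec R x) = ext_vec S x.
Proof. by apply/rowP => k; rewrite !mxE rmorph_alg. Qed.

Lemma map_ext_lie (R S : comAlgType F) (h : {lrmorphism R -> S}) v w :
  map_mx h (ext_lie v w) = ext_lie (map_mx h v) (map_mx h w).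
Proof.
apply/rowP => k; rewrite !mxE linear_sum; apply: eq_bigr => i _.
rewrite linear_sum; apply: eq_bigr => j _.
by rewrite linearZ /= rmorphM !mxE.
Qed.

(** The structure constants lie in [F], over which [d] is linear, so the Leibniz rule passes to the
    bracket. *)
Lemma derivation_ext_lie (R : comAlgType F) (d : {linear R -> R}) v w :
  (forall a c, d (a * c) = d a * c + a * d c) ->
  map_mx d (ext_lie v w) = ext_lie (map_mx d v) w + ext_lie v (map_mx d w).
Proof.
move=> dM; apply/rowP => k; rewrite !mxE linear_sum -big_split.
apply: eq_bigr => i _; rewrite linear_sum -big_split; apply: eq_bigr => j _.
by rewrite linearZ /= dM scalerDr !mxE.
Qed.
End ScalarExtension.

Lemma sum_tuple_cons (V : nmodType) (T : finType) N (G : seq T -> V) :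
  \sum_(s : N.+1.-tuple T) G s = \sum_(x : T) \sum_(s : N.-tuple T) G (x :: s).
Proof.
rewrite pair_bigA /= (reindex (fun xs : T * N.-tuple T => [tuple of xs.1 :: xs.2])) //.
exists (fun s : N.+1.-tuple T => (thead s, [tuple of behead s])) => [[x s] _|s _] /=.
  by congr (_, _); apply: val_inj.
by rewrite [RHS]tuple_eta.
Qed.

(** * The power map in characteristic p *)

Section PowerMap.
Variables (F : fieldType) (E : lieAlgType F).
Local Notation n := (\dim {:E}).
Local Notation b := (vbasis {:E}).

Lemma foldl_lie0 (w : seq E) : foldl lie 0 w = 0 :> E.
Proof. by elim: w => //= x w; rewrite lie0l. Qed.

Lemma lie_foldl_last (x : E) w : w != [::] ->
  lie (foldl lie x (take (size w).-1 w)) (last 0 w) = foldl lie x w.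
Proof.
case/lastP: w => // w y _.
by rewrite size_rcons -cats1 take_size_cat // last_cat /= foldl_cat.
Qed.

Definition bool_word (x y : E) (s : seq bool) : seq E :=
  [seq if c then x else y | c <- s].

(** The leading [x] is split off, whence the successor in the denominator. Continuations starting
    with [x] may be added because [[x, x] = 0]. *)
Lemma star_sum_lie p (x y : E) : (1 < p)%N -> star_sum p lie x y =
  \sum_(s : p.-1.-tuple bool)
    (count_mem true s).+1%:R^-1 *: foldl lie x (bool_word x y s).
Proof.
case: p => // -[|q] // _; rewrite /star_sum big_mkcond /=.
pose G s := if take 2 s == [:: true; false] then
  (count_mem true s)%:R^-1 *:
    lie (lie_word (take q.+1 (bool_word x y s))) (last 0 (bool_word x y s)) else 0.
rewrite -[LHS]/(\sum_(s : q.+2.-tuple bool) G s).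
pose H s := (count_mem true s).+1%:R^-1 *: foldl lie x (bool_word x y s).
rewrite -[RHS]/(\sum_(s : q.+1.-tuple bool) H s).
rewrite (sum_tuple_cons _ H) !big_bool (sum_tuple_cons _ G) big_bool.
rewrite [X in _ + X = _]big1 ?addr0 => [|s _]; last first.
  by rewrite /G; case: s => -[|[] s].
rewrite [X in _ = X + _]big1 ?add0r => [|s _]; last first.
  by rewrite /H /= liexx foldl_lie0 scaler0.
rewrite (sum_tuple_cons _ (fun s => G (true :: s))) big_bool.
rewrite [X in X + _ = _]big1 ?add0r //.
apply: eq_bigr => s _; rewrite /G /H /= take0 eqxx /= add0n.
have /= <- := @lie_foldl_last x (y :: bool_word x y s) isT.
by rewrite size_map size_tuple.
Qed.

Lemma iter_ext_lie_linear (R : comAlgType F) N (u : 'rV[R]_n) :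
  linear (iter N (@ext_lie F E R ^~ u)).
Proof. by move=> a v w; elim: N => //= N ->; rewrite ext_lie_linearl. Qed.

Lemma iter_ext_lie_vec (R : comAlgType F) N (x y : E) :
  iter N (@ext_lie F E R ^~ (ext_vec R y)) (ext_vec R x) =
  ext_vec R (iter N (lie^~ y) x).
Proof. by elim: N => //= N ->; rewrite ext_lie_vec. Qed.

(** Each bracket chooses [x] or [y], and the exponent of ['X] records how often [x] is chosen. *)
Lemma iter_ext_lie_line N (x y z : E) :
  iter N (@ext_lie F E {poly F} ^~ ('X *: ext_vec _ x + ext_vec _ y)) (ext_vec _ z) =
  \sum_(s : N.-tuple bool)
     'X^(count_mem true s) *: ext_vec {poly F} (foldl lie z (bool_word x y s)).
Proof.
elim: N z => [|N IHN] z.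
  rewrite (big_pred1 [tuple]) ?expr0 ?scale1r // => s.
  by rewrite [s]tuple0; apply/esym/eqP.
rewrite iterSr (sum_tuple_cons _ (fun s => 'X^(count_mem true s) *:
  ext_vec {poly F} (foldl lie z (bool_word x y s)))) big_bool.
have -> : ext_lie (ext_vec {poly F} z) ('X *: ext_vec _ x + ext_vec _ y) =
    'X *: ext_vec {poly F} (lie z x) + ext_vec {poly F} (lie z y).
  by rewrite ext_lie_linearr !ext_lie_vec.
rewrite iter_ext_lie_linear !IHN scaler_sumr; congr (_ + _).
by apply: eq_bigr => s _; rewrite scalerA -exprS.
Qed.

(** With indeterminate coordinates, degrees and partial derivatives make sense even over a finite
    field, where functions do not determine polynomials. *)
Definition generic_vec : 'rV[{mpoly F[n]}]_n := \row_i 'X_i.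

Definition generic_power N (x : E) : 'rV[{mpoly F[n]}]_n :=
  iter N (@ext_lie F E {mpoly F[n]} ^~ generic_vec) (ext_vec _ x).

Lemma generic_power_at (S : comAlgType F) (v : 'I_n -> S) N x :
  map_mx (mpoly_at v) (generic_power N x) =
  iter N (@ext_lie F E S ^~ (\row_i v i)) (ext_vec S x).
Proof.
rewrite /generic_power; elim: N => [|N IHN] /=; first by rewrite map_ext_vec.
rewrite map_ext_lie IHN; congr ext_lie.
by apply/rowP => i; rewrite !mxE /= mpoly_atX.
Qed.

Lemma generic_power_homog N x k : generic_power N x 0 k \is N.-homog.
Proof.
elim: N k => [|N IHN] k.
  by rewrite mxE; apply: dhomogZ; apply: dhomog1.
rewrite mxE rpred_sum // => i _; rewrite rpred_sum // => j _.
rewrite rpredZ // -[N.+1]addn1 dhomogM // ?IHN // mxE dhomogX /=.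
by rewrite mdeg1.
Qed.

(** The coefficient is the value at the basis vector e_i, where the innermost bracket is [[e_i, e_i]
    = 0]. *)
Lemma generic_power_diag N (i : 'I_n) k :
  (generic_power N.+1 b`_i 0 k)@_(U_(i) *+ N.+1) = 0.
Proof.
rewrite -mpoly_at_delta ?generic_power_homog //.
have := generic_power_at (fun j => (j == i)%:R : F^o) N.+1 b`_i.
have -> : \row_j ((j == i)%:R : F^o) = ext_vec _ b`_i.
  by rewrite ext_vec_basis; apply/rowP => j; rewrite !mxE eqxx.
rewrite iter_ext_lie_vec iterSr liexx.
have -> : iter N (lie^~ b`_i) 0 = 0 :> E by elim: N => //= N ->; rewrite lie0l.
move=> /rowP/(_ k); rewrite !mxE linear0 => ->.
by rewrite scale0r.
Qed.

(** Differentiation replaces one occurrence of the generic vector by the basis vector e_j; [a]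
    counts the brackets applied afterwards. *)
Lemma mderiv_generic_power N x (j : 'I_n) :
  map_mx (mderiv j) (generic_power N x) =
  \sum_(a < N) iter a (@ext_lie F E _ ^~ generic_vec)
    (ext_lie (generic_power (N.-1 - a) x) (ext_vec _ b`_j)).
Proof.
have dX : map_mx (mderiv j) generic_vec = ext_vec _ b`_j.
  rewrite ext_vec_basis; apply/rowP => i; rewrite !mxE eqxx mderivX mnm1E.
  have [->|_] := eqVneq i j; last by rewrite scale0r.
  by rewrite -{1}[U_(j)%MM]add0m addmK mpolyX0 scale1r.
elim: N => [|N IHN].
  rewrite big_ord0; apply/rowP => i; rewrite !mxE mderivZ.
  by rewrite -mpolyC1 mderivC scaler0.
rewrite {1}/generic_power iterS -/(generic_power N x).
rewrite derivation_ext_lie; last exact: mderivM.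
rewrite dX IHN big_ord_recl subn0 addrC; congr (_ + _).
rewrite (big_morph _ (ext_lieDl _) (ext_lie0l _)).
by apply: eq_bigr => a _; rewrite /= /bump add1n subnS -predn_sub.
Qed.

Lemma generic_power_closed p (i j : 'I_n) : p \in [pchar F] ->
  map_mx (mderiv j) (generic_power p.-1 b`_i) =
  map_mx (mderiv i) (generic_power p.-1 b`_j).
Proof.
move=> charFp; have pr_p := pcharf_prime charFp.
rewrite !mderiv_generic_power.
case: p charFp pr_p => [|[|q]] // charFp pr_p.
(* The bracket is flipped because the inner iterate stands on its left in [mderiv_generic_power] and
   on its right in [closed_form_sym]. *)
apply: (@closed_form_sym 'rV[{mpoly F[n]}]_n (fun v w => ext_lie w v)) => //.
- by move=> v w; rewrite ext_lieC.
- exact: ext_lieDl.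
- by move=> v w; rewrite ext_lie_jacobi addrC.
by move=> v; rewrite -scaler_nat -mpolyC_nat pcharf0 // mpolyC0 scale0r.
Qed.

Lemma generic_power_coord N x :
  generic_power N x = \sum_(i < n) (coord b i x)%:A *: generic_power N b`_i.
Proof.
have gpP a y z : generic_power N (a *: y + z) =
    a%:A *: generic_power N y + generic_power N z.
  by rewrite /generic_power ext_vecP iter_ext_lie_linear.
have gp0 : generic_power N 0 = 0.
  by have := gpP (-1) 0 0; rewrite addr0 scaler0 scaleN1r scaleN1r addNr.
rewrite {1}(coord_vbasis (memvf x)); elim/big_rec2: _ => // i v y _ IHv.
by rewrite gpP IHv.
Qed.

Lemma generic_power_line N x y k :
  mpoly_line (coord b ^~ x) (coord b ^~ y) (generic_power N x 0 k) =
  \sum_(s : N.-tuple bool)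
    coord b k (foldl lie x (bool_word x y s)) *: 'X^(count_mem true s).
Proof.
have /rowP/(_ k) := generic_power_at
  (fun i => coord b i x *: 'X + (coord b i y)%:P : {poly F}) N x.
rewrite mxE /= -/(mpoly_line _ _ _) => ->.
have -> : \row_i (coord b i x *: 'X + (coord b i y)%:P) =
    'X *: ext_vec {poly F} x + ext_vec _ y.
  by apply/rowP => i; rewrite !mxE -[RHS]/('X * _ + _) mulrC mulr_algl alg_polyC.
rewrite iter_ext_lie_line summxE; apply: eq_bigr => s _.
by rewrite !mxE -[LHS]/('X^_ * _) mulrC mulr_algl.
Qed.

Lemma exists_power_map p : p \in [pchar F] ->
  exists P : E -> E,
    (forall a x, P (a *: x) = a ^+ p *: P x) /\
    (forall x y, P (x + y) = P x + P y + star_sum p lie x y).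
Proof.
move=> charFp; have p_gt1 := prime_gt1 (pcharf_prime charFp).
have p_gt0 := ltnW p_gt1.
have /fin_all_exists2[f f_homog df] k : exists2 fk : {mpoly F[n]},
    fk \is p.-homog & forall i : 'I_n, fk^`M(i) = generic_power p.-1 b`_i 0 k.
  apply: (mpoly_potential charFp) => [i|i j|i].
  - exact: generic_power_homog.
  - by have /rowP/(_ k) := @generic_power_closed p i j charFp; rewrite !mxE.
  (* Since [p > 1], at least one bracket occurs, as [generic_power_diag] requires. *)
  - by rewrite -(prednK (n := p.-1)) ?generic_power_diag // -ltnS prednK.
pose crd (x : E) (i : 'I_n) : F^o := coord b i x.
exists (fun x => \sum_k mpoly_at (crd x) (f k) *: b`_k); split=> [a x|x y].
  rewrite scaler_sumr; apply: eq_bigr => k _; rewrite scalerA; congr (_ *: _).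
  rewrite (eq_mpoly_at _ (_ : crd (a *: x) =1 fun i => (a : F^o) * crd x i)).
    by rewrite (mpoly_atZ _ _ (f_homog k)).
  by move=> i; rewrite /crd linearZ.
rewrite [star_sum _ _ _ _](coord_vbasis (memvf _)) -!big_split.
apply: eq_bigr => k _ /=; rewrite -!scalerDl; congr (_ *: _).
(* The constant coefficient of [G], its coefficient of degree [p] and its value at 1 are the
   coordinates of the images of [y], [x] and [x + y]. The middle coefficients must therefore add up
   to the coordinate of [star_sum]. *)
set G := mpoly_line (crd x) (crd y) (f k).
have [sG Gp] := mpoly_line_top (crd x) (crd y) (f_homog k).
have G0 : G`_0 = mpoly_at (crd y) (f k).
  rewrite -horner_coef0; apply: horner_mpoly_line => i.
  by rewrite mulr0 add0r.
have G1 : G.[1] = mpoly_at (crd (x + y)) (f k).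
  by apply: horner_mpoly_line => i; rewrite mulr1 /crd linearD.
have dG : G^`() = \sum_(s : p.-1.-tuple bool)
    coord b k (foldl lie x (bool_word x y s)) *: 'X^(count_mem true s).
  rewrite -generic_power_line deriv_mpoly_line generic_power_coord summxE.
  rewrite /mpoly_line linear_sum; apply: eq_bigr => i _ /=.
  by rewrite df [in RHS]mxE mulr_algl mpoly_at_scalable.
have -> : mpoly_at (crd (x + y)) (f k) = G`_0 + \sum_(i < p.-1) G`_i.+1 + G`_p.
  rewrite -G1 (horner_coef_wide _ sG) big_ord_recr /= expr1n mulr1; congr (_ + _).
  under eq_bigr => i _ do rewrite expr1n mulr1.
  by case: (p) p_gt0 => // q _; rewrite big_ord_recl.
rewrite G0 Gp addrC addrA; congr (_ + _).
have -> : coord b k (star_sum p lie x y) = \sum_(s : p.-1.-tuple bool)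
    (count_mem true s).+1%:R^-1 * coord b k (foldl lie x (bool_word x y s)).
  by rewrite star_sum_lie // linear_sum; apply: eq_bigr => s _; rewrite linearZ.
(* The middle coefficients are recovered from the derivative, since [0 < i.+1 < p] makes [i.+1]
   invertible. *)
transitivity (\sum_(i < p.-1) (i.+1)%:R^-1 * G^`()`_i).
  apply: eq_bigr => i _; rewrite coef_deriv -[X in _ * X]mulr_natl mulKf //.
  by rewrite -(dvdn_pcharf charFp) gtnNdvd // -ltn_predRL.
rewrite dG; under eq_bigr => i _ do rewrite coef_sum mulr_sumr.
rewrite exchange_big; apply: eq_bigr => s _ /=.
under eq_bigr => i _ do rewrite coefZ coefXn.
have [lt_s|le_s] := ltnP (count_mem true s) p.-1.
  rewrite (bigD1 (Ordinal lt_s)) //= eqxx mulr1 big1 ?addr0 // => i ni.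
  rewrite (_ : (_ == _) = false) ?mulr0 //.
  by apply: contraNF ni => /eqP Ei; apply/eqP/val_inj.
have Es : (count_mem true s).+1 = p.
  apply: etrans (prednK p_gt0); congr _.+1; apply/eqP.
  by rewrite eqn_leq le_s andbT (leq_trans (count_size _ _)) ?size_tuple.
(* The words consisting of [x] alone contribute [p%:R^-1 = 0^-1 = 0]. *)
rewrite Es pcharf0 // invr0 mul0r big1 // => i _.
by rewrite ltn_eqF ?mulr0 // (leq_trans (ltn_ord i)).
Qed.
End PowerMap.

(** * The central extension defined by a cocycle *)

Section CentralExtension.
Variables (F : fieldType) (g : lieAlgType F).

(** The cocycle is recorded in the type so that the bracket it defines can be inferred from the
    type. *)
Definition central_ext (z : Z2 g) : Type := (g * F^o)%type.

Variable z : Z2 g.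
Local Notation E := (central_ext z).
Local Notation phi := (val z).

HB.instance Definition _ := Vector.on E.

Definition central_bracket (u v : E) : E := (lie u.1 v.1, phi u.1 v.1).

Fact central_bracket_linearl v : linear (central_bracket^~ v).
Proof.
have /boolp.asboolP[[phil _ _] _] := valP z.
by move=> a u w; congr (_, _); rewrite /= ?lie_linearl ?phil.
Qed.

Fact central_bracket_linearr v : linear (central_bracket v).
Proof.
have /boolp.asboolP[[_ phir _] _] := valP z.
by move=> a u w; congr (_, _); rewrite /= ?lie_linearr ?phir.
Qed.

Fact central_bracketxx v : central_bracket v v = 0.
Proof.
have /boolp.asboolP[[_ _ phixx] _] := valP z.
by congr (_, _); rewrite ?liexx ?phixx.
Qed.

Fact central_bracket_jacobi u v w :
  central_bracket (central_bracket u v) w + central_bracket (central_bracket v w) u +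
  central_bracket (central_bracket w u) v = 0.
Proof.
have /boolp.asboolP[[phil _ _] dphi] := valP z.
congr (_, _); first exact: lie_jacobi.
have phiN x y : phi (- x) y = - phi x y.
  have phi0 : phi 0 y = 0.
    by have := phil y (-1) 0 0; rewrite addr0 scaler0 scaleN1r addNr.
  by have := phil y (-1) x 0; rewrite !addr0 !scaleN1r phi0 addr0.
rewrite /= -[RHS](dphi u.1 v.1 w.1) /delta2 (lieC w.1 u.1) phiN.
by rewrite addrAC.
Qed.

HB.instance Definition _ := Vector_isLie.Build F E central_bracket_linearl
  central_bracket_linearr central_bracketxx central_bracket_jacobi.

Lemma fst_lie_word (w : seq E) : (lie_word w).1 = lie_word (map fst w).
Proof.
case: w => //= x w; elim: w x => //= y w IHw x; exact: IHw.
Qed.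

(** The central component of the outermost bracket is [phi] of the projections to [g]; thus
    Jacobson's term in [E] yields the sum of the star property. *)
Lemma snd_star_sum p (x y : g) :
  (star_sum p lie ((x, 0) : E) (y, 0)).2 = star_sum p phi x y.
Proof.
rewrite /star_sum (big_morph snd (id1 := 0) (op1 := +%R)) //.
apply: eq_bigr => s _ /=; congr (_ *: phi _ _).
  rewrite fst_lie_word map_take -map_comp; congr (lie_word (take _ _)).
  by apply: eq_map => -[].
rewrite -(last_map (fst : E -> g)) -map_comp; congr (last _ _).
by apply: eq_map => -[].
Qed.
End CentralExtension.

Lemma star_property_exists (F : fieldType) p (g : restrictedLieAlgType F p)
    (z : Z2 g) : p \in [pchar F] -> exists omega, star_property (val z) omega.
Proof.
move=> charFp.
have [P [PZ PD]] := @exists_power_map F (central_ext z) p charFp.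
(* The section [x |-> (x, 0)] is linear, so the identities for [P] can be applied along it. *)
exists (fun x => (P (x, 0)).2); split=> [a x|x y].
  have -> : (a *: x, 0) = a *: ((x, 0) : central_ext z).
    by congr (_, _); rewrite /= scaler0.
  by rewrite PZ.
have -> : (x + y, 0) = ((x, 0) : central_ext z) + (y, 0).
  by congr (_, _); rewrite /= addr0.
by rewrite PD /= snd_star_sum.
Qed.

(* In the central extension, (ad y)^p - ad y^[p] is a derivation with central
   values, so it vanishes on commutators. *)
Lemma res_cocycle_condition (F : fieldType) p (g : restrictedLieAlgType F p)
    (z : Z2 g) (x y : g) : p \in [pchar F] -> lie_simple g ->
  val z x (ppow y) - val z (lie_word (x :: nseq p.-1 y)) y = 0.
Proof.
move=> charFp simple.
have p_gt0 : (0 < p)%N by rewrite prime_gt0 // (pcharf_prime charFp).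
have /boolp.asboolP[[phil phir _] _] := valP z.
rewrite /= foldl_lie_nseq.
(* The defect of the condition is linear in [x], so it suffices that it vanish on brackets. *)
pose chi x := val z x (ppow y) - val z (iter p.-1 (lie^~ y) x) y.
have iter_lin n : linear (iter n (lie^~ y)).
  by move=> a u v; elim: n => //= n ->; rewrite lie_linearl.
have chi_lin : linear chi.
  move=> a u v; rewrite /chi iter_lin !phil scalerBr opprD.
  by rewrite [LHS]addrACA.
apply: (lie_simple_linear_eq0 (psi := linear_pack chi_lin)) => // {x} u v.
pose yh : central_ext z := (y, 0); pose yp : central_ext z := (ppow y, 0).
have iterE (w : central_ext z) : iter p (lie^~ yh) w =
    (iter p (lie^~ y) w.1, val z (iter p.-1 (lie^~ y) w.1) y).
  have fst_iter n : (iter n (lie^~ yh) w).1 = iter n (lie^~ y) w.1.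
    by elim: n => //= n ->.
  have iterSp T (f : T -> T) w' : iter p f w' = f (iter p.-1 f w').
    by rewrite -iterS prednK.
  by rewrite !iterSp -!fst_iter.
(* The sign between right brackets and [ad] is [(-1) ^+ p], which is [-1] in [F] also for
   [p = 2]. *)
have diff (w : central_ext z) :
    iter p (lie^~ yh) w = lie w yp + ((0, - chi w.1) : central_ext z).
  rewrite iterE; congr (_, _) => /=; last by rewrite opprB addrC subrK.
  rewrite addr0 iter_lie_sign lieC lie_ppow.
  by rewrite -(pFrobenius_autE charFp) pFrobenius_autN pFrobenius_aut1 scaleN1r.
have central c (w : central_ext z) : lie ((0, c) : central_ext z) w = 0.
  have phi0 : val z 0 w.1 = 0.
    by have := phil w.1 (-1) 0 0; rewrite addr0 scaler0 scaleN1r addNr.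
  by congr (_, _); rewrite /= ?lie0l ?phi0.
have central' c (w : central_ext z) : lie w ((0, c) : central_ext z) = 0.
  by rewrite lieC central oppr0.
(* The [p]-fold bracket with [yh] and the single bracket with [yp] are both derivations. Comparing
   them on [[u, v]], where brackets with central elements vanish, leaves [chi (lie u v) = 0]. *)
have := iter_lie_pchar yh ((u, 0) : central_ext z) (v, 0) charFp.
rewrite !diff lie_derivation lieDl lieDr central central' !addr0.
move=> /(canRL (addKr _)); rewrite addNr => /(congr1 snd) /= /eqP.
by rewrite oppr_eq0 => /eqP.
Qed.

(** * Dimensions *)

Section FiniteDimension.
Variable F : fieldType.

(* Unlike [has_dim], this notion passes to subspaces and to quotients without
   constructing a basis, and it still implies that [V] has a dimension. *)
Definition dim_bounded (V : lmodType F) N :=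
  forall n (i : {linear 'rV[F]_n -> V}), injective i -> (n <= N)%N.

Lemma linear_inj (V W : lmodType F) (f : {linear V -> W}) :
  (forall v, f v = 0 -> v = 0) -> injective f.
Proof.
by move=> f0 u v Euv; apply/subr0_eq/f0; rewrite linearB Euv subrr.
Qed.

Lemma linear_bij_inv (V W : lmodType F) (f : {linear V -> W}) :
  injective f -> (forall w, exists v, f v = w) ->
  exists h : {linear W -> V}, cancel h f /\ cancel f h.
Proof.
move=> finj f_surj; have [h fh] := boolp.choice f_surj.
have h_lin : linear h by move=> a u v; apply: finj; rewrite linearP !fh.
exists (linear_pack h_lin).
by split=> //= v; apply: finj; rewrite fh.
Qed.

Lemma linear_lift (V W : lmodType F) n (q : {linear W -> V})
    (i : {linear 'rV[F]_n -> V}) : (forall v, exists w, q w = v) ->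
  exists j : {linear 'rV[F]_n -> W}, forall v, q (j v) = i v.
Proof.
move=> q_surj; have [w qw] := boolp.choice (fun k => q_surj (i (delta_mx 0 k))).
pose j (v : 'rV[F]_n) := \sum_k v 0 k *: w k.
have j_lin : linear j.
  move=> a u v; rewrite /j scaler_sumr -big_split; apply: eq_bigr => k _ /=.
  by rewrite !mxE scalerDl scalerA.
exists (linear_pack j_lin) => v /=.
rewrite {2}[v]row_sum_delta !linear_sum; apply: eq_bigr => k _.
by rewrite !linearZ /= qw.
Qed.

Lemma linear_section (V W : lmodType F) n (q : {linear W -> V}) :
  (forall v, exists w, q w = v) -> has_dim V n ->
  exists s : {linear V -> W}, cancel s q.
Proof.
move=> q_surj [[c c_lin c_bij]].
pose cL : {linear V -> 'rV[F]_n} := linear_pack c_lin.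
have [d ck dk] := c_bij.
have [|r [rK cK]] := @linear_bij_inv _ _ cL (can_inj ck).
  by move=> w; exists (d w).
have [j qj] := linear_lift r q_surj.
by exists (j \o cL) => v /=; rewrite qj cK.
Qed.

(** An injection from a row space of maximal dimension is onto, since a missed vector would extend
    it by one dimension. *)
Lemma dim_bounded_has_dim (V : lmodType F) N :
  dim_bounded V N -> exists n, has_dim V n.
Proof.
move=> bV; pose P n := boolp.asbool (exists i : {linear 'rV[F]_n -> V}, injective i).
have P0 : exists n, P n.
  exists 0%N; apply/boolp.asboolP; exists \0 => u v _; apply/rowP; case=> //.
have PN n : P n -> (n <= N)%N by move=> /boolp.asboolP[i /bV].
have [n /boolp.asboolP[i i_inj] n_max] := ex_maxnP P0 PN.
exists n; suff i_surj v : exists w, i w = v.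
  have [h [hK iK]] := linear_bij_inv i_inj i_surj.
  by constructor; exists h; [exact: linearP | exists i].
apply: boolp.contrapT => nv.
pose k (w : 'rV[F]_(n + 1)) := i (lsubmx w) + rsubmx w 0 0 *: v.
have k_lin : linear k.
  move=> a u w; rewrite /k !linearP !mxE scalerDr scalerDl scalerA.
  by rewrite [LHS]addrACA.
pose kL : {linear 'rV[F]_(n + 1) -> V} := linear_pack k_lin.
suff /n_max : P (n + 1)%N by rewrite addn1 ltnn.
apply/boolp.asboolP; exists kL; apply: linear_inj => w /= kw.
have r0 : rsubmx w 0 0 = 0.
  apply/eqP/negPn/negP => nz; apply: nv.
  exists ((rsubmx w 0 0)^-1 *: - lsubmx w); rewrite linearZ linearN /=.
  move/eqP: kw; rewrite /k addr_eq0 => /eqP ->.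
  by rewrite opprK scalerA mulVf // scale1r.
have l0 : lsubmx w = 0 by apply: i_inj; rewrite linear0 -kw /k r0 scale0r addr0.
rewrite -[w]hsubmxK l0 (_ : rsubmx w = 0) ?row_mx0 //.
by apply/matrixP => a b; rewrite !ord1 r0 mxE.
Qed.

Lemma dim_bounded_row N : dim_bounded 'rV[F]_N N.
Proof.
move=> n i i_inj.
have /eqP <- : row_free (lin1_mx i).
  apply: inj_row_free => v; rewrite mul_rV_lin1 => iv.
  by apply: i_inj; rewrite iv linear0.
exact: rank_leq_col.
Qed.

Lemma dim_bounded_sub (V W : lmodType F) N (f : {linear V -> W}) :
  injective f -> dim_bounded W N -> dim_bounded V N.
Proof. by move=> f_inj bW n i i_inj; apply: (bW n (f \o i)); apply: inj_comp. Qed.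

Lemma dim_bounded_quot (V W : lmodType F) N (q : {linear W -> V}) :
  (forall v, exists w, q w = v) -> dim_bounded W N -> dim_bounded V N.
Proof.
move=> q_surj bW n i i_inj; have [j qj] := linear_lift i q_surj.
by apply: (bW n j) => u v /(congr1 q); rewrite !qj => /i_inj.
Qed.

Lemma has_dim_pair (V W : lmodType F) m n :
  has_dim V m -> has_dim W n -> has_dim (V * W)%type (m + n).
Proof.
move=> [[c c_lin [c' cK c'K]]] [[d d_lin [d' dK d'K]]].
constructor; exists (fun vw => row_mx (c vw.1) (d vw.2)).
  by move=> a u v; rewrite c_lin d_lin scale_row_mx add_row_mx.
exists (fun r => (c' (lsubmx r), d' (rsubmx r))) => [[v w]|r] /=.
  by rewrite row_mxKl row_mxKr cK dK.
by rewrite c'K d'K hsubmxK.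
Qed.

Lemma has_dim_iso (V W : lmodType F) n (f : {linear V -> W}) :
  bijective f -> has_dim W n -> has_dim V n.
Proof.
move=> f_bij [[c c_lin c_bij]]; constructor; exists (c \o f).
  by move=> a u v; rewrite /= linearP c_lin.
exact: bij_comp.
Qed.
End FiniteDimension.

Lemma lmod_proj_eq0 (R : nzRingType) (V : lmodType R) (I : submodClosed V) x :
  (lmod_proj I x == 0) = (x \in I).
Proof. by rewrite -(linear0 (lmod_proj I)) lmod_proj_eq subr0. Qed.

(** A cocycle is determined by its matrix of values on a basis, so [Z2 g] embeds in a space of
    matrices, and [H2 g] is a quotient of it. *)
Lemma has_dim_H2 (F : fieldType) (g : lieAlgType F) : exists n, has_dim (H2 g) n.
Proof.
pose n := \dim {:g}; pose b := vbasis {:g}.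
pose entries (z : Z2 g) : 'M[F]_n := \matrix_(i, j) val z b`_i b`_j.
have e_lin : linear (fun z => mxvec (entries z)).
  move=> a z z'; rewrite -linearP; congr mxvec; apply/matrixP => i j.
  by rewrite !mxE.
have e_inj : injective (linear_pack e_lin).
  move=> z z' /= /(can_inj mxvecK)/matrixP Ezz'; apply: val_inj.
  apply: boolp.funext => x; apply: boolp.funext => y.
  have /boolp.asboolP[[phil phir _] _] := valP z.
  have /boolp.asboolP[[phil' phir' _] _] := valP z'.
  rewrite (coord_vbasis (memvf x)) (coord_vbasis (memvf y)).
  have sumE (h h' : g -> F^o) : linear h -> linear h' ->
      (forall i : 'I_n, h b`_i = h' b`_i) -> forall c : 'I_n -> F,
      h (\sum_i c i *: b`_i) = h' (\sum_i c i *: b`_i).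
    move=> hl hl' hb c.
    rewrite -[h]/(linear_pack hl : _ -> _) -[h']/(linear_pack hl' : _ -> _).
    by rewrite !linear_sum; apply: eq_bigr => i _; rewrite !linearZ /= hb.
  apply: (sumE ((val z)^~ _) ((val z')^~ _)) => // i.
  apply: sumE => // j.
  by have := Ezz' i j; rewrite !mxE.
apply: (@dim_bounded_has_dim _ _ (n * n)).
apply: (@dim_bounded_quot F (H2 g) (Z2 g) _ (lmod_proj (@coboundary2 F g))).
  by move=> u; exists (lmod_repr u); exact: lmod_projK.
exact: dim_bounded_sub e_inj (@dim_bounded_row F _).
Qed.

(** A p-semilinear map amounts to arbitrary values on a basis. The Frobenius twist affects only the
    coordinates of the argument, so the map depends linearly on these values. *)
Lemma has_dim_homFr (F : fieldType) p (g : vectType F) :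
  p \in [pchar F] -> has_dim (homFr p g F^o) (\dim {:g}).
Proof.
move=> charFp; pose n := \dim {:g}; pose b := vbasis {:g}.
have p_gt0 : (0 < p)%N by rewrite prime_gt0 // (pcharf_prime charFp).
pose to_row (f : homFr p g F^o) : 'rV[F]_n := \row_k val f b`_k.
pose of_row (r : 'rV[F]_n) (x : g) : F^o := \sum_k coord b k x ^+ p * r 0 k.
have of_rowP r : of_row r \in @frobenius_hom F p g F^o.
  apply/boolp.asboolP => a c x y; rewrite /of_row !scaler_sumr -big_split.
  apply: eq_bigr => k _ /=.
  have -> : coord b k (a *: x + c *: y) = a * coord b k x + c * coord b k y.
    by rewrite linearD !linearZ.
  rewrite -(pFrobenius_autE charFp) rmorphD !rmorphM /= !pFrobenius_autE.
  by rewrite mulrDl -!mulrA.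
constructor; exists to_row.
  by move=> a f h; apply/rowP => k; rewrite !mxE.
exists (fun r => exist _ (of_row r) (of_rowP r)) => [f|r]; last first.
  apply/rowP => k; rewrite mxE /= /of_row (bigD1 k) //= big1 ?addr0.
    by rewrite coord_free ?(basis_free (vbasisP _)) // eqxx expr1n mul1r.
  move=> i ni; rewrite coord_free ?(basis_free (vbasisP _)) //.
  by rewrite eq_sym (negPf ni) expr0n gtn_eqF ?mul0r.
apply: val_inj; apply: boolp.funext => x /=; rewrite /of_row.
have /boolp.asboolP fP := valP f.
have f0 : val f 0 = 0.
  have /eqP := fP 1 1 0 0; rewrite expr1n !scale1r addr0.
  by rewrite -subr_eq subrr => /eqP/esym.
rewrite {2}(coord_vbasis (memvf x)); elim/big_rec2: _ => // k v y _ ->.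
by have := fP (coord b k x) 1 b`_k v; rewrite scale1r expr1n scale1r mxE => ->.
Qed.

(** * Restricted cohomology *)

Section RestrictedExactSequence.
Variables (F : fieldType) (p : nat) (g : restrictedLieAlgType F p).

Fact res_Z2_fst_cocycle (c : res_Z2 g) : (val c).1 \in @cocycle2 F g.
Proof. by have /boolp.asboolP[? _ ? _] := valP c; apply/boolp.asboolP. Qed.

Definition res_Z2_fst (c : res_Z2 g) : Z2 g := exist _ (val c).1 (res_Z2_fst_cocycle c).

Lemma val_res_Z2_fst c : val (res_Z2_fst c) = (val c).1.
Proof. by []. Qed.

Fact res_Z2_fst_linear : linear res_Z2_fst.
Proof. by move=> a c d; apply: val_inj. Qed.

HB.instance Definition _ :=
  GRing.isLinear.Build F (res_Z2 g) (Z2 g) *:%R res_Z2_fst res_Z2_fst_linear.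

Definition fr_cochain (u : g -> F^o) : (g -> g -> F^o) * (g -> F^o) :=
  (fun _ _ => 0, u).

Fact fr_cocycle_subproof (f : homFr p g F^o) :
  fr_cochain (val f) \in @res_cocycle2 F p g.
Proof.
have /boolp.asboolP fP := valP f.
have f0 : val f 0 = 0.
  have /eqP := fP 1 1 0 0; rewrite expr1n !scale1r addr0.
  by rewrite -subr_eq subrr => /eqP/esym.
apply/boolp.asboolP; split=> /=.
- exact: cochain2_0.
- split=> [a x|x y].
    by have := fP a 0 x 0; rewrite f0 !scaler0 !addr0.
  rewrite /star_sum big1 ?addr0 => [|s _]; last by rewrite /= scaler0.
  by have := fP 1 1 x y; rewrite expr1n !scale1r.
- by move=> x y z; rewrite /delta2 subrr addr0.
- by move=> x y; rewrite subrr.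
Qed.

Definition fr_cocycle (f : homFr p g F^o) : res_Z2 g :=
  exist _ (fr_cochain (val f)) (fr_cocycle_subproof f).

Fact fr_cocycle_linear : linear fr_cocycle.
Proof.
move=> a f h; apply: val_inj; congr (_, _).
by rewrite /= scaler0 addr0.
Qed.

HB.instance Definition _ := GRing.isLinear.Build F (homFr p g F^o) (res_Z2 g)
  *:%R fr_cocycle fr_cocycle_linear.

Hypotheses (charFp : p \in [pchar F]) (simple : lie_simple g).

Lemma res_Z2_fst_surj (z : Z2 g) : exists c, res_Z2_fst c = z.
Proof.
have [omega sP] := star_property_exists z charFp.
have zP : (val z, omega) \in @res_cocycle2 F p g.
  have /boolp.asboolP[? ?] := valP z; apply/boolp.asboolP; split => //= x y.
  exact: res_cocycle_condition.
by exists (exist _ (val z, omega) zP); apply: val_inj.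
Qed.

Lemma res_Z2_fst_ker (c : res_Z2 g) : res_Z2_fst c = 0 -> exists f, c = fr_cocycle f.
Proof.
move=> /(congr1 val) /= c0.
have /boolp.asboolP[_ [Z D] _ _] := valP c.
have cP : (val c).2 \in @frobenius_hom F p g F^o.
  apply/boolp.asboolP => a b x y; rewrite D !Z c0.
  by rewrite /star_sum big1 ?addr0 // => s _; rewrite scaler0.
exists (exist _ (val c).2 cP); apply: val_inj; rewrite [LHS]surjective_pairing.
by congr (_, _).
Qed.

Lemma res_Z2_fst_fr (f : homFr p g F^o) : res_Z2_fst (fr_cocycle f) = 0.
Proof. exact: val_inj. Qed.

Lemma res_H2_iso :
  exists f : {linear res_H2 g -> (H2 g * homFr p g F^o)%type}, bijective f.
Proof.
have [n dimH2] := has_dim_H2 g.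
pose q : {linear res_Z2 g -> H2 g} := lmod_proj (@coboundary2 F g) \o res_Z2_fst.
have q_eq0 c : (q c == 0) = (res_Z2_fst c \in @coboundary2 F g).
  exact: (lmod_proj_eq0 (@coboundary2 F g)).
have q_surj u : exists c, q c = u.
  have [c Ec] := res_Z2_fst_surj (lmod_repr u); exists c.
  by rewrite /= Ec; exact: lmod_projK.
(* The isomorphism is built in the opposite direction, from a chosen linear section of restricted
   cocycles over [H2 g]. *)
have [s sK] := linear_section q_surj dimH2.
pose h (uf : H2 g * homFr p g F^o) : res_H2 g :=
  lmod_proj (@res_coboundary2 F p g) (s uf.1 + fr_cocycle uf.2).
have h_lin : linear h.
  move=> a u v; rewrite /h -linearP scalerDr addrACA -!linearP.
  by [].
have h_inj : injective (linear_pack h_lin).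
  apply: linear_inj => -[u f]; move/eqP.
  rewrite lmod_proj_eq0 => /boolp.asboolP[psi Epsi].
  have u0 : u = 0.
    have qf : q (fr_cocycle f) = 0 by rewrite /= res_Z2_fst_fr linear0.
    have <- : q (s u + fr_cocycle f) = u by rewrite linearD sK qf addr0.
    apply/eqP; rewrite q_eq0; apply/boolp.asboolP; exists psi.
    by rewrite val_res_Z2_fst Epsi.
  move: Epsi; rewrite u0 linear0 add0r => Epsi.
  (* The bilinear component of [fr_cocycle f] is zero, so [psi] kills all brackets. *)
  have psi0 : forall x, psi x = 0.
    apply: lie_simple_linear_eq0 => // x y.
    by rewrite -[LHS]/((res_delta1 psi).1 x y) -Epsi.
  congr (_, _); apply: val_inj; apply: boolp.funext => x.
  by rewrite -[LHS]/((val (fr_cocycle f)).2 x) Epsi /= psi0.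
(* Removing [s (q c)] from a representative [c] leaves a cocycle over some [delta1 psi]; subtracting
   [res_delta1 psi] brings it into the kernel of [res_Z2_fst]. *)
have h_surj w : exists uf, linear_pack h_lin uf = w.
  pose c := lmod_repr w; pose d := c - s (q c).
  have /eqP : q d = 0 by rewrite linearB sK subrr.
  rewrite q_eq0 => /boolp.asboolP[psi Epsi].
  pose e : res_Z2 g := exist _ (res_delta1 psi) (res_delta1_cocycle2 psi charFp).
  have Ede : res_Z2_fst d = res_Z2_fst e by apply: val_inj; rewrite Epsi.
  have [|f Ef] := @res_Z2_fst_ker (d - e); first by rewrite linearB /= Ede subrr.
  exists (q c, f); apply/esym/eqP; rewrite -[w]lmod_projK lmod_proj_eq -/c /=.
  rewrite -Ef opprD addrA -/d opprB addrC subrK.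
  by apply/boolp.asboolP; exists psi.
have [f [fK hK]] := linear_bij_inv h_inj h_surj.
by exists f; exists h.
Qed.
End RestrictedExactSequence.

Theorem theorem3p1 (F : fieldType) (p : nat) (hp : p \in [pchar F])
    (g : restrictedLieAlgType F p) (hg : lie_simple g) :
  (exists f : {linear res_H2 g -> (H2 g * homFr p g F^o)%type}, bijective f) /\
  (exists m n : nat,
     [/\ has_dim (res_H2 g) m, has_dim (H2 g) n & m = (n + \dim {:g})%N]).
Proof.
have [f f_bij] := res_H2_iso hp hg.
split; first by exists f.
have [n dimH2] := has_dim_H2 g.
exists (n + \dim {:g})%N, n; split=> //.
exact: has_dim_iso f_bij (has_dim_pair dimH2 (has_dim_homFr _ hp)).
Qed.
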